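(* Let $I$ be a regular icosahedron with edge length $\ell$ and center $O$, with vertices labeled $N,S,U_1,\dots,U_5,L_1,\dots,L_5$ as described in the context, and let $\mathcal{F}$ be the set of the ten triangles $F_S(i)=\triangle(S,U_i,L_i)$ and $F_N(i)=\triangle(N,U_i,L_{i-1})$, $i=1,\dots,5$ (with $L_0:=L_5$). For $F\in\mathcal{F}$ let $p(F)$ be the midpoint of the cross-edge of $F$ (the edge of $F$ not incident to its pole). Let $R$ be the radius of the circle centered at $O$, in the plane $\Pi$ through $O$ perpendicular to the line $NS$, on which the ten points $p(F)$, $F\in\mathcal{F}$, lie. Then $$R=\frac{\varphi}{2}\,\ell,$$ where $\varphi=\frac{1+\sqrt5}{2}$.
   Context: $I$ is a regular icosahedron in $\mathbb{R}^3$ with edge length $\ell>0$ and center $O$. Its 12 vertices are labeled $V=\{N,S,U_1,\dots,U_5,L_1,\dots,L_5\}$, with indices taken modulo $5$. Here $N$ and $S$ are opposite vertices (the poles), and the line $NS$ is called the rotation axis. The vertices $U_1,\dots,U_5$ (upper ring) are the five neighbors of $N$, labeled cyclically so that $U_i$ is adjacent to $U_{i+1}$; the vertices $L_1,\dots,L_5$ (lower ring) are the five neighbors of $S$, labeled cyclically so that $L_i$ is adjacent to $L_{i+1}$; and the lower-ring vertices adjacent to $U_i$ are exactly $L_i$ and $L_{i-1}$. ''Adjacent'' means joined by an edge of the icosahedron. $\triangle(A,B,C)$ denotes the triangle with vertices $A,B,C$. The equatorial plane is $\Pi=\{x\in\mathbb{R}^3:(x-O)\cdot(N-S)=0\}$.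 The pole of $F_S(i)$ is $S$ and the pole of $F_N(i)$ is $N$. The cross-edge $c(F)$ of a face $F\in\mathcal{F}$ is the edge of $F$ not incident to its pole, so $c(F_S(i))=U_iL_i$ and $c(F_N(i))=U_iL_{i-1}$, and $p(F)$ is the midpoint of $c(F)$. *)

(* Defs.v *)
From HB Require Import structures.
From mathcomp Require Import all_boot all_order all_algebra.
From mathcomp Require Import boolp classical_sets functions cardinality reals.
From mathcomp Require Import convex.

Set Implicit Arguments.
Unset Strict Implicit.
Unset Printing Implicit Defensive.

Import Order.TTheory GRing.Theory Num.Theory.

Local Open Scope classical_set_scope.
Local Open Scope card_scope.
Local Open Scope ring_scope.

Definition golden_ratio (R : realType) : R := (1 + Num.sqrt 5) / 2.

(* The norm that the library puts on row vectors is the sup norm, so the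
   Euclidean structure of R^3 is introduced here. *)
Definition dot (R : realType) (u v : 'rV[R]_3) : R := \sum_i u 0 i * v 0 i.

Definition edist (R : realType) (A B : 'rV[R]_3) : R :=
  Num.sqrt (dot (A - B) (A - B)).

Definition midpoint (R : realType) (A B : 'rV[R]_3) : 'rV[R]_3 :=
  2^-1 *: (A + B).

Definition convex_hull (R : realType) (X : set 'rV[R]_3) : set 'rV[R]_3 :=
  smallest (@convex_set R 'rV[R]_3) X.

Definition plane (R : realType) (O n : 'rV[R]_3) : set 'rV[R]_3 :=
  [set x | dot (x - O) n = 0].

Definition circle (R : realType) (O n : 'rV[R]_3) (r : R) : set 'rV[R]_3 :=
  [set x | plane O n x /\ edist O x = r].

Definition convex_polyhedron (R : realType) (P : set 'rV[R]_3) :=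
  (exists2 X, finite_set X & P = convex_hull X) /\
  ~ exists O n, n != 0 /\ P `<=` plane O n.

(* For a convex polyhedron these are the vertices, edges and facets, as point
   sets: P itself is excluded because it lies in no plane. *)
Definition is_face (R : realType) (P F : set 'rV[R]_3) :=
  F !=set0 /\
  exists n b, [/\ n != 0, forall x, P x -> dot n x <= b &
                  F = [set x | P x /\ dot n x = b]].

Definition vertex (R : realType) (P : set 'rV[R]_3) (A : 'rV[R]_3) :=
  is_face P [set A].

Definition edge (R : realType) (P : set 'rV[R]_3) (A B : 'rV[R]_3) :=
  A != B /\ is_face P (convex_hull [set A; B]).

Definition facet (R : realType) (P F : set 'rV[R]_3) :=
  is_face P F /\ forall G, is_face P G -> F `<=` G -> G = F.

Definition equilateral_triangle (R : realType) (F : set 'rV[R]_3) :=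
  exists A B C, [/\ A != B, edist A B = edist B C, edist B C = edist C A &
                    F = convex_hull [set A; B; C]].

Record regular_icosahedron (R : realType) (P : set 'rV[R]_3) : Prop :=
  RegularIcosahedron {
    ico_polyhedron : convex_polyhedron P;
    ico_facets : [set F | facet P F] #= `I_20;
    ico_equilateral : forall F, facet P F -> equilateral_triangle F;
    ico_vertex_degree : forall A, vertex P A ->
      [set F | facet P F /\ F A] #= `I_5
  }.

Definition has_edge_length (R : realType) (P : set 'rV[R]_3) (l : R) :=
  forall A B, edge P A B -> edist A B = l.

(* The center of the circumscribed sphere; the vertices of a convex polyhedron
   are not coplanar, so there is at most one such point. *)
Definition center (R : realType) (P : set 'rV[R]_3) (O : 'rV[R]_3) :=
  forall A B, vertex P A -> vertex P B -> edist O A = edist O B.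

(* The ring indices 1, ..., 5 are taken in the integers modulo 5, so that
   index 5 is 0. *)
Record icosahedron_labelling (R : realType) (P : set 'rV[R]_3)
    (O N S : 'rV[R]_3) (U L : 'Z_5 -> 'rV[R]_3) : Prop :=
  IcosahedronLabelling {
    labels_distinct : uniq (N :: S :: codom U ++ codom L);
    labels_vertices : [set A | vertex P A] = [set N; S] `|` range U `|` range L;
    poles_opposite : midpoint N S = O;
    upper_ring : [set A | edge P N A] = range U;
    lower_ring : [set A | edge P S A] = range L;
    upper_cyclic : forall i, edge P (U i) (U (i + 1));
    lower_cyclic : forall i, edge P (L i) (L (i + 1));
    rings_adjacent : forall i j, edge P (U i) (L j) <-> j = i \/ j = i - 1
  }.

(* A triangle given by its vertices, with one of them singled out as its pole;
   the cross-edge joins the other two. *)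
Record polar_triangle (R : realType) := PolarTriangle {
  pole : 'rV[R]_3;
  cross_fst : 'rV[R]_3;
  cross_snd : 'rV[R]_3
}.

Definition cross_midpoint (R : realType) (F : polar_triangle R) : 'rV[R]_3 :=
  midpoint (cross_fst F) (cross_snd F).

Definition F_S (R : realType) (S : 'rV[R]_3) (U L : 'Z_5 -> 'rV[R]_3)
  (i : 'Z_5) : polar_triangle R := PolarTriangle S (U i) (L i).

Definition F_N (R : realType) (N : 'rV[R]_3) (U L : 'Z_5 -> 'rV[R]_3)
  (i : 'Z_5) : polar_triangle R := PolarTriangle N (U i) (L (i - 1)).

Definition polar_faces (R : realType) (N S : 'rV[R]_3)
    (U L : 'Z_5 -> 'rV[R]_3) : set (polar_triangle R) :=
  range (F_S S U L) `|` range (F_N N U L).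

(* Main.v *)
Require Import Defs.
From mathcomp Require Import all_boot all_order all_algebra.
From mathcomp Require Import boolp classical_sets reals.
From mathcomp Require Import interval_inference convex ring lra.

Import Order.TTheory GRing.Theory Num.Theory.

Local Open Scope classical_set_scope.
Local Open Scope ring_scope.

(** Put the origin at [O] and let [n] be the vector to the north pole [N], of
    squared length [k].  All vertices lie on the sphere of radius [sqrt k], and
    every edge has length [l], so every two adjacent vertices have the same
    inner product [h = k - l ^+ 2 / 2].  Hence the upper ring lies in the plane
    [dot n x = h], and since [S = - N] the lower ring lies in the opposite
    plane.  The midpoint of a cross-edge is thus in the equatorial plane, and
    its squared distance to [O] is [(k + h) / 2 = k - l ^+ 2 / 4].  What remains
    is to find [k] in terms of [l].

    The upper ring, projected along the axis, is a planar cycle of five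
    distinct points of a circle, with equal steps.  Such a cycle obeys
    [V (i + 1) + V (i - 1) = t *: V i] with [t] twice the cosine of the step
    angle, and closing up after five steps forces [t ^+ 2 + t = 1]
    ([equilateral_pentagon]).

    Metric data alone cannot decide between the two roots: the vertices of the
    great icosahedron, whose rings are pentagrams, satisfy the same equations
    with the negative root.  Convexity decides: an edge of a convex polyhedron
    has a linear functional that is maximal on this edge only
    ([edge_support]), which is impossible for a side of a pentagram
    ([convex_pentagon_ratio_gt0]).  So [t] is the golden ratio minus 1, and
    comparing [t] with the ratio of inner products computed from [k] and [h]
    gives [k] ([pentagonal_cone_radius]). *)

(** * The Euclidean inner product *)

Section Dot.
Variable R : realType.
Implicit Types (a b c n u v w z : 'rV[R]_3) (k : R).

Lemma dotC u v : dot u v = dot v u.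
Proof. by apply: eq_bigr => i _; rewrite mulrC. Qed.

Lemma dotDl u v w : dot (u + v) w = dot u w + dot v w.
Proof. by rewrite -big_split; apply: eq_bigr => i _; rewrite mxE mulrDl. Qed.

Lemma dotZl k u w : dot (k *: u) w = k * dot u w.
Proof. by rewrite /dot mulr_sumr; apply: eq_bigr => i _; rewrite mxE mulrA. Qed.

Lemma dotDr u v w : dot w (u + v) = dot w u + dot w v.
Proof. by rewrite dotC dotDl !(dotC w). Qed.

Lemma dotZr k u w : dot w (k *: u) = k * dot w u.
Proof. by rewrite dotC dotZl (dotC w). Qed.

Lemma dotNl u w : dot (- u) w = - dot u w.
Proof. by rewrite -scaleN1r dotZl mulN1r. Qed.

Lemma dotNr u w : dot w (- u) = - dot w u.
Proof. by rewrite dotC dotNl dotC. Qed.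

Definition dotE := (dotDl, dotDr, dotNl, dotNr, dotZl, dotZr).

Lemma dot_ge0 u : 0 <= dot u u.
Proof. by apply: sumr_ge0 => i _; rewrite -expr2 sqr_ge0. Qed.

Lemma dot_eq0 u : (dot u u == 0) = (u == 0).
Proof.
apply/eqP/eqP => [u0|->]; last by apply: big1 => i _; rewrite mxE mul0r.
apply/rowP => i; rewrite mxE; apply/eqP; rewrite -sqrf_eq0 expr2.
by apply/eqP; move: i isT; apply: psumr_eq0P => // i _; rewrite -expr2 sqr_ge0.
Qed.

Lemma sqr_edist u v : edist u v ^+ 2 = dot (u - v) (u - v).
Proof. by rewrite sqr_sqrtr // dot_ge0. Qed.

(** The matrix with rows [a], [b], [c] has a diagonal Gram matrix with nonzero
    determinant, hence is invertible, and it kills [z]. *)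
Lemma orthogonal_basis_eq0 a b c z :
    a != 0 -> b != 0 -> c != 0 ->
    dot a b = 0 -> dot a c = 0 -> dot b c = 0 ->
    dot a z = 0 -> dot b z = 0 -> dot c z = 0 -> z = 0.
Proof.
move=> a0 b0 c0 ab ac bc az bz cz.
pose e (i : 'I_3) := nth 0 [:: a; b; c] i.
pose M : 'M[R]_3 := \matrix_i e i.
have M_dot (i : 'I_3) (w : 'rV[R]_3) : (M *m w^T) i 0 = dot (e i) w.
  by rewrite mxE; apply: eq_bigr => j _; rewrite !mxE.
have MMt : M *m M^T = diag_mx (\row_i dot (e i) (e i)).
  apply/matrixP => i j; transitivity (dot (e i) (e j)).
    by rewrite mxE; apply: eq_bigr => k _; rewrite !mxE.
  rewrite !mxE; case: eqVneq => [->//|ij]; rewrite mulr0n.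
  case: i j ij => [[|[|[|i]]] hi] [[|[|[|j]]] hj] //= _; rewrite /e /=;
    by rewrite // dotC.
have Munit : M \in unitmx.
  have: \det (M *m M^T) != 0.
    rewrite MMt det_diag; apply/prodf_neq0 => i _; rewrite mxE dot_eq0.
    by case: i => [[|[|[|i]]] hi].
  by rewrite det_mulmx det_tr mulf_eq0 orbb unitmxE unitfE.
have Mz : M *m z^T = 0.
  apply/colP => i; rewrite M_dot mxE.
  by case: i => [[|[|[|i]]] hi].
by apply: trmx_inj; rewrite -[LHS](mulKmx Munit) Mz mulmx0 trmx0.
Qed.

(** In the plane orthogonal to [n], the vectors [b] and [b'] are mirror images
    in the line of [a], because they have equal lengths and equal inner
    products with [a].  In the proof, [n], [a] and [b - b'] are an orthogonal
    basis, and the difference of the two sides is orthogonal to all three. *)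
Lemma coplanar_bisector n a b b' :
    n != 0 -> a != 0 -> b != b' ->
    dot n a = 0 -> dot n b = 0 -> dot n b' = 0 ->
    dot b b = dot b' b' -> dot a b = dot a b' ->
  b + b' = (2 * dot a b / dot a a) *: a.
Proof.
move=> n0 a0 bb' na nb nb' eqb eqab; apply/eqP; rewrite -subr_eq0; apply/eqP.
have aa0 : dot a a != 0 by rewrite dot_eq0.
apply: (@orthogonal_basis_eq0 n a (b - b')); rewrite ?subr_eq0 // !dotE.
- by rewrite nb nb' subrr.
- by rewrite eqab subrr.
- by rewrite na nb nb' mulr0 subr0 addr0.
- by rewrite -eqab divfK //; ring.
- by rewrite (dotC b a) (dotC b' a) (dotC b' b) -eqb eqab; ring.
Qed.

End Dot.

Arguments dotC {R}.

(** * Supporting functionals of edges *)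

Section Faces.
Variables (R : realType) (P : set 'rV[R]_3).
Implicit Types A B C : 'rV[R]_3.

Lemma convex_open_halfspace (n : 'rV[R]_3) (b : R) :
  @convex_set R 'rV[R]_3 [set x | dot n x < b].
Proof.
apply/convex_setW => x y; rewrite !inE /= => xb yb k k0 k1; rewrite inE.
change (dot n (k%:num *: x + (1 - k%:num) *: y) < b).
by rewrite !dotE; nra.
Qed.

(** The functional that exposes the vertex [C] takes smaller values at [A] and
    [B], so their segment lies in an open half-space that misses [C]. *)
Lemma vertex_notin_segment A B C :
  vertex P C -> P A -> P B -> C != A -> C != B ->
  ~ convex_hull [set A; B] C.
Proof.
case=> _ [m [b [m0 Pb eqC]]] PA PB CA CB.
have below X : P X -> C != X -> dot m X < b.
  move=> PX CX; rewrite lt_neqAle Pb // andbT.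
  apply: contra CX => /eqP mX.
  have : [set C] X by rewrite eqC.
  by move=> ->.
have mC : dot m C = b.
  by have : [set C] C by []; rewrite {1}eqC => -[].
have hull_below : convex_hull [set A; B] `<=` [set x | dot m x < b].
  apply: smallest_sub; first exact: convex_open_halfspace.
  by move=> X [->|->] /=; apply: below.
by move/hull_below; rewrite /= mC ltxx.
Qed.

Lemma vertex_in A : vertex P A -> P A.
Proof.
by case=> _ [n [b [_ _ eqA]]]; have : [set A] A by []; rewrite eqA => -[].
Qed.

(** The functional that cuts the edge out of [P] is maximal on this edge only,
    and a vertex other than the two ends is not on the edge. *)
Lemma edge_support A B : edge P A B ->
  exists n, dot n A = dot n B /\
    forall C, vertex P C -> C != A -> C != B -> dot n C < dot n A.
Proof.
case=> _ [_ [n [b [_ Pb eqF]]]].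
have onF X : [set A; B] X -> P X /\ dot n X = b.
  move=> X_AB; have : convex_hull [set A; B] X by apply: sub_gen_smallest.
  by rewrite eqF.
have [PA nA] := onF A (or_introl erefl).
have [PB nB] := onF B (or_intror erefl).
exists n; split=> [|C vC CA CB]; first by rewrite nA nB.
have PC := vertex_in _ vC.
rewrite nA lt_neqAle Pb // andbT; apply/eqP => nC.
apply: (vertex_notin_segment _ _ _ vC PA PB CA CB).
by rewrite eqF.
Qed.

End Faces.

(** * Closed equilateral pentagons *)

Section Pentagon.
Variable R : realType.
Implicit Types (V : 'Z_5 -> 'rV[R]_3) (n : 'rV[R]_3) (t r c : R).

(** Stated over any module because it serves both for the points of a pentagon
    and for the values of a linear functional on them. *)
Lemma five_cycle_unroll (M : lmodType R) (V : 'Z_5 -> M) (t : R) :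
    (forall i, V (i + 1) + V (i - 1) = t *: V i) ->
  [/\ V 2 = t *: V 1 - V 0, V 3 = t *: V 2 - V 1,
      V 4 = t *: V 3 - V 2 & V 4 = t *: V 0 - V 1].
Proof.
move=> rec.
have e (i j k : 'Z_5) : j = i + 1 -> k = i - 1 -> V j = t *: V i - V k.
  by move=> -> ->; rewrite -rec addrK.
have e' (i j k : 'Z_5) : j = i - 1 -> k = i + 1 -> V j = t *: V i - V k.
  by move=> -> ->; rewrite -rec (addrC (V (i + 1))) addrK.
by split; first [apply: e; exact/val_inj | apply: e'; exact/val_inj].
Qed.

(** A cycle of five distinct points of a circle, with equal steps, is a regular
    pentagon or a regular pentagram: [t] is twice the cosine of the step angle.
    Going around the cycle in both directions to [V 4] gives
    [(t ^+ 2 + t - 1) *: (V 0 - (t - 1) *: V 1) = 0].  If the second factor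
    vanished, equal lengths would give [t = 0] or [t = 2].  The first makes
    [V 0 = - V 1] orthogonal to [V 1], the second makes [V 0 = V 1]. *)
Lemma equilateral_pentagon V n r c :
    n != 0 -> injective V -> (forall i, dot n (V i) = 0) ->
    (forall i, dot (V i) (V i) = r) -> (forall i, dot (V i) (V (i + 1)) = c) ->
  exists t, [/\ t ^+ 2 + t = 1, 2 * c = t * r &
                forall i, V (i + 1) + V (i - 1) = t *: V i].
Proof.
move=> n0 injV nV Vr Vc.
have V01 : V 0 != V 1 by apply/eqP => /injV.
have Vpred i : dot (V i) (V (i - 1)) = c.
  by rewrite dotC -[in V i](subrK 1 i) Vc.
have r0 : r != 0.
  apply: contra V01 => /eqP r0.
  have V0 i : V i = 0 by apply/eqP; rewrite -dot_eq0 Vr r0.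
  by rewrite !V0.
pose t := 2 * c / r; exists t.
have rec i : V (i + 1) + V (i - 1) = t *: V i.
  rewrite (@coplanar_bisector _ n (V i)) ?Vr ?Vc ?Vpred //.
  - by rewrite -dot_eq0 Vr.
  - apply/eqP => /injV /(can_inj (addKr i)) /eqP.
    by rewrite -val_eqE.
have tr : 2 * c = t * r by rewrite divfK.
clearbody t; split=> //; apply/eqP; rewrite -subr_eq0.
have [E2 E3 E4 E4'] := five_cycle_unroll _ _ _ rec.
apply/negP => /negP q0.
have V0E : V 0 = (t - 1) *: V 1.
  apply: (scalerI q0); rewrite scalerA.
  have := E4; rewrite E4' E3 E2 => /eqP; rewrite -subr_eq0 => /eqP eq0.
  apply/eqP; rewrite -subr_eq0 -[X in _ == X]eq0; apply/eqP/rowP => j.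
  by rewrite !mxE; ring.
have := Vr 0; have := Vc 0; rewrite add0r V0E !dotE Vr => ec er.
have : (t * (t - 2)) * r == 0 by apply/eqP; move: er; lra.
rewrite !mulf_eq0 (negPf r0) orbF subr_eq0 => /orP[] /eqP tE.
  by move/eqP: r0; apply; move: ec tr; rewrite tE; lra.
by move/eqP: V01; apply; rewrite V0E tE -[1]/(1%:R) -natrB // scale1r.
Qed.

(** Think of [f] as a linear functional restricted to the pentagon.  If [b] is
    its value on the side from 0 to 1, the recurrence makes those at 2 and 3
    [(t - 1) * b] and [- (2 * t) * b].  For the pentagram, [t < -1], and so the
    first being below [b] makes [b] positive, while the second makes it
    negative. *)
Lemma convex_pentagon_ratio_gt0 (f : 'Z_5 -> R^o) t :
    t ^+ 2 + t = 1 -> (forall i, f (i + 1) + f (i - 1) = t *: f i) ->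
    f 0 = f 1 -> f 2 < f 0 -> f 3 < f 0 -> 0 < t.
Proof.
move=> t2 rec f01 f20 f30.
have [E2 E3 _ _] := five_cycle_unroll R^o _ _ rec.
rewrite E3 E2 -f01 in f30; rewrite E2 -f01 in f20.
move: (f 0) f20 f30 => b; rewrite /GRing.scale /= => f2 f3.
rewrite ltNge; apply/negP => t_le0.
have t_lt : t < -1 by nra.
have b_gt0 : 0 < b by nra.
have : - (2 * t) * b < b.
  have -> // : - (2 * t) * b = t * (t * b - b) - b.
  transitivity ((t ^+ 2 + t - 1 - 2 * t) * b); last by ring.
  by rewrite t2 subrr add0r.
by nra.
Qed.

End Pentagon.

(** * The golden ratio *)

Section GoldenRatio.
Variable R : realType.

Lemma golden_ratio_gt0 : 0 < golden_ratio R.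
Proof. by rewrite divr_gt0 // ltr_pwDl // sqrtr_ge0. Qed.

Lemma golden_ratio_sqr : golden_ratio R ^+ 2 = golden_ratio R + 1.
Proof.
have s5 : Num.sqrt (5 : R) ^+ 2 = 5 by rewrite sqr_sqrtr.
by rewrite /golden_ratio; move: s5; set s := Num.sqrt _ => s5; nra.
Qed.

Lemma golden_ratio_subr1_unique (t : R) :
  0 < t -> t ^+ 2 + t = 1 -> t = golden_ratio R - 1.
Proof.
move=> t0 t2; have g0 := golden_ratio_gt0; have g2 := golden_ratio_sqr.
have /eqP : (t - (golden_ratio R - 1)) * (t + golden_ratio R) = 0 by nra.
by rewrite mulf_eq0 => /orP[/eqP|/eqP]; lra.
Qed.

End GoldenRatio.

(** * The radius of the equatorial circle *)

Section Radius.
Variable R : realType.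

(** The left-hand side is the squared distance from the center to the midpoint
    of an edge.  The vectors [V i] are the projections of the ring [u i] along
    the axis [n]: they have squared length [k - h ^+ 2 / k] and consecutive
    inner product [h - h ^+ 2 / k], and twice the ratio of the latter to the
    former is [2 * h / (k + h)], which must be the golden ratio minus 1.  The
    functional [m] is there to rule out a pentagram. *)
Lemma pentagonal_cone_radius (n : 'rV[R]_3) (u : 'Z_5 -> 'rV[R]_3) (l : R) :
    0 < l -> injective u -> (forall i, dot (u i) (u i) = dot n n) ->
    (forall i, dot (n - u i) (n - u i) = l ^+ 2) ->
    (forall i, dot (u i - u (i + 1)) (u i - u (i + 1)) = l ^+ 2) ->
    (exists m, [/\ dot m (u 0) = dot m (u 1),
       dot m (u 2) < dot m (u 0) & dot m (u 3) < dot m (u 0)]) ->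
  dot n n - l ^+ 2 / 4 = (golden_ratio R / 2 * l) ^+ 2.
Proof.
move=> l0 inju un nul uul [m [m01 m20 m30]].
have l2 : 0 < l ^+ 2 by rewrite exprn_gt0.
pose k := dot n n; pose h := k - l ^+ 2 / 2.
have nu i : dot n (u i) = h.
  by have := nul i; rewrite !dotE (dotC _ n) un /h /k; lra.
have uu i : dot (u i) (u (i + 1)) = h.
  by have := uul i; rewrite !dotE (dotC (u (i + 1)) (u i)) !un /h /k; lra.
have n0 : n != 0.
  apply/eqP => n0; have : u 0 = u 1.
    have u0 i : u i = 0.
      by apply/eqP; rewrite -dot_eq0 un n0 dot_eq0.
    by rewrite !u0.
  by move/inju.
have k_gt0 : 0 < k by rewrite lt_neqAle dot_ge0 eq_sym dot_eq0 n0.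
have k0 : k != 0 by rewrite gt_eqF.
pose V i := u i - (h / k) *: n.
have injV : injective V by move=> i j /addIr /inju.
have nV i : dot n (V i) = 0.
  by rewrite !dotE nu -/k divfK // subrr.
have VV i : dot (V i) (V i) = k - h ^+ 2 / k.
  by rewrite !dotE un (dotC _ n) nu -/k; field.
have VVs i : dot (V i) (V (i + 1)) = h - h ^+ 2 / k.
  by rewrite !dotE uu (dotC _ n) !nu -/k; field.
have [t [t2 tr rec]] := equilateral_pentagon _ _ _ _ _ n0 injV nV VV VVs.
have t_gt0 : 0 < t.
  apply: (convex_pentagon_ratio_gt0 _ (fun i => dot m (V i))) => // [i|||].
  - by rewrite -dotDr rec dotZr.
  - by rewrite !dotE m01.
  - by rewrite !dotE ltrD2r.
  - by rewrite !dotE ltrD2r.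
have tE := golden_ratio_subr1_unique _ _ t_gt0 t2.
have kh : k - h = l ^+ 2 / 2 by rewrite /h; lra.
have ratio : 2 * h = t * (k + h).
  (* The pentagon relation is this one multiplied by [(k - h) / k]. *)
  have kh0 : (k - h) / k != 0 by rewrite mulf_neq0 ?invr_eq0 // kh; lra.
  apply: (mulIf kh0); transitivity (2 * (h - h ^+ 2 / k)); first by field.
  by rewrite tr; field.
have g2 := golden_ratio_sqr R.
move: tE g2; set g := golden_ratio R => tE g2.
rewrite tE in ratio.
have -> : dot n n - l ^+ 2 / 4 = (k + h) / 2 by rewrite /h -/k; lra.
rewrite exprMn (_ : (g / 2) ^+ 2 = (g + 1) / 4); last by rewrite -g2; field.
have -> : l ^+ 2 = 2 * (k - h) by rewrite kh; field.
have kE : k = h * (2 * g - 1).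
  (* Multiplying by [g] clears it from the coefficient of [k]:
     [g * (g - 1) = 1]. *)
  have : g * (2 * h) = (g ^+ 2 - g) * (k + h) by rewrite ratio; ring.
  by rewrite g2; lra.
by rewrite kE; nra.
Qed.

End Radius.

Theorem theorem5 (R : realType) (P : set 'rV[R]_3) (l : R)
    (O N S : 'rV[R]_3) (U L : 'Z_5 -> 'rV[R]_3)
    (l_gt0 : 0 < l)
    (icoP : regular_icosahedron P)
    (edgeP : has_edge_length P l)
    (centerP : center P O)
    (labelP : icosahedron_labelling P O N S U L) :
  (exists r, forall F, polar_faces N S U L F ->
     circle O (N - S) r (cross_midpoint F)) /\
  (forall r, (forall F, polar_faces N S U L F ->
     circle O (N - S) r (cross_midpoint F)) ->
   r = golden_ratio R / 2 * l).
Proof.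
suff onC F : polar_faces N S U L F ->
    circle O (N - S) (golden_ratio R / 2 * l) (cross_midpoint F).
  split; first by exists (golden_ratio R / 2 * l).
  have F0 : polar_faces N S U L (F_S S U L 0) by left; exists 0.
  by move=> r /(_ _ F0) [_ <-]; have [_ ->] := onC _ F0.
case: labelP => dist verts opp edgeN edgeS edgeU edgeL edgeUL.
have vN : vertex P N.
  by have : [set A | vertex P A] N by rewrite verts; left; left; left.
have vU i : vertex P (U i).
  by have : [set A | vertex P A] (U i) by rewrite verts; left; right; exists i.
have vL i : vertex P (L i).
  by have : [set A | vertex P A] (L i) by rewrite verts; right; exists i.
have NU i : edge P N (U i).
  by have : range U (U i) by [exists i]; rewrite -edgeN.
have SL i : edge P S (L i).
  by have : range L (L i) by [exists i]; rewrite -edgeS.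
have injU : injective U.
  move: dist => /= /andP[_ /andP[_]]; rewrite cat_uniq => /andP[+ _].
  by move=> /injectiveP.
pose n := N - O; pose u i := U i - O; pose w i := L i - O.
have SO : S - O = - n.
  by rewrite /n -opp; apply/rowP => j; rewrite !mxE; field.
have sphere A : vertex P A -> dot (A - O) (A - O) = dot n n.
  move=> vA; have E (B : 'rV[R]_3) : dot (B - O) (B - O) = edist O B ^+ 2.
    by rewrite sqr_edist -[B - O]opprB !dotE; ring.
  by rewrite !E (centerP _ _ vA vN).
have edge_sqr A B : edge P A B ->
    dot ((A - O) - (B - O)) ((A - O) - (B - O)) = l ^+ 2.
  by move=> eAB; rewrite opprB addrA subrK -sqr_edist edgeP.
have main : dot n n - l ^+ 2 / 4 = (golden_ratio R / 2 * l) ^+ 2.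
  apply: (pentagonal_cone_radius _ _ u) => //.
  - by move=> i j /addIr /injU.
  - by move=> i; apply: sphere.
  - by move=> i; apply: edge_sqr.
  - by move=> i; apply: edge_sqr.
  have [m [m01 below]] := edge_support _ _ _ _ (edgeU 0).
  exists m; rewrite add0r in m01 below; rewrite /u !dotE m01; split=> //.
    by rewrite ltrD2r -m01; apply: below => //; apply/eqP => /injU.
  by rewrite ltrD2r -m01; apply: below => //; apply/eqP => /injU.
have on_circle i j : edge P (U i) (L j) ->
    circle O (N - S) (golden_ratio R / 2 * l) (midpoint (U i) (L j)).
  move=> eUL.
  have un := sphere _ (vU i); have wn := sphere _ (vL j).
  have nu := edge_sqr _ _ (NU i); have nw := edge_sqr _ _ (SL j).
  have uw := edge_sqr _ _ eUL.
  rewrite -/(u i) in un nu uw; rewrite -/(w j) in wn nw uw.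
  rewrite -/n in nu; rewrite SO in nw.
  have mE : midpoint (U i) (L j) - O = 2^-1 *: (u i + w j).
    by apply/rowP => k; rewrite !mxE; field.
  have NS : N - S = 2 *: n.
    by rewrite /n -opp; apply/rowP => k; rewrite !mxE; field.
  clearbody n u w; rewrite !dotE in nu nw uw.
  rewrite (dotC (u i) n) in nu; rewrite (dotC (w j) n) in nw.
  rewrite (dotC (w j) (u i)) in uw.
  split.
    rewrite /plane /= mE NS !dotE (dotC (u i) n) (dotC (w j) n); lra.
  have g0 := golden_ratio_gt0 R.
  rewrite -[RHS]ger0_norm; last by rewrite mulr_ge0 ?divr_ge0 // ltW.
  rewrite -sqrtr_sqr -main /edist -opprB mE; congr Num.sqrt.
  by rewrite !dotE (dotC (w j) (u i)); lra.
case=> [[i _ <-]|[i _ <-]]; apply: on_circle; apply/edgeUL; first by left.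
by right.
Qed.
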